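(* Let $p:\mathbb{R}^l\to\mathbb{R}$ be a polynomial in $l$ variables, and consider the problem $\min_{x\in\mathbf{u}}p(x)$ with $\mathbf{u}=[0,1]^l$. Suppose there are $m<\infty$ global minimizers $x_1^*,\dots,x_m^*$ of this problem, none of them on the boundary of $\mathbf{u}$, and that the Hessian $\nabla^2p$ is positive definite at each of these minimizers. Then after sufficiently many iterations of the Parallel Constrained Bernstein Algorithm (PCBA), the number of Bernstein patches remaining (i.e. the length of the list $\mathcal{L}$ maintained by the algorithm) is bounded by a constant (independent of the iteration number).
   Context: Boxes and Bernstein patches. A box is $\mathbf{x}=[\underline{x}_1,\overline{x}_1]\times\cdots\times[\underline{x}_l,\overline{x}_l]\subset\mathbb{R}^l$ with $\underline{x}_\mu<\overline{x}_\mu$. The multi-degree $N=(n_1,\dots,n_l)$ of a polynomial $p$ records the largest power of each variable occurring in $p$. Over a box $\mathbf{x}$, $p$ is uniquely written $p(x)=\sum_{0\le J\le N}B_J^{(N)}(\mathbf{x})\,b_J^{(N)}(\mathbf{x},x)$, with $b_J^{(N)}(\mathbf{x},x)=\prod_{\mu=1}^l\binom{n_\mu}{j_\mu}\frac{(x_\mu-\underline{x}_\mu)^{j_\mu}(\overline{x}_\mu-x_\mu)^{n_\mu-j_\mu}}{(\overline{x}_\mu-\underline{x}_\mu)^{n_\mu}}$. The array of Bernstein coefficients $B_p(\mathbf{x})=(B_J^{(N)}(\mathbf{x}))_{J\le N}$ is the (Bernstein) patch of $p$ over $\mathbf{x}$; $\min B_p(\mathbf{x})$ and $\max B_p(\mathbf{x})$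 are its smallest and largest entries. PCBA for the problem $\min_{x\in\mathbf{u}}p(x)$ (all points of $\mathbf{u}$ feasible). The algorithm maintains a list $\mathcal{L}$ of subboxes of $\mathbf{u}$ with their patches, starting with $\mathcal{L}=\{\mathbf{u}\}$. In each iteration, for $r=1,\dots,l$ in turn: every box in $\mathcal{L}$ is replaced by its two halves obtained by bisecting it in the $r$-th direction (with the corresponding patches), and then the cut-off test is applied: with $p^*_{\mathrm{up}}=\min_{\mathbf{x}\in\mathcal{L}}\max B_p(\mathbf{x})$, every $\mathbf{x}\in\mathcal{L}$ that is suboptimal, i.e. $\min B_p(\mathbf{x})>p^*_{\mathrm{up}}$, is removed. Thus after $n$ iterations every box in $\mathcal{L}$ has width $2^{-n}$. The statement concerns the list $\mathcal{L}$ after $n$ iterations as $n$ grows, with the iterations continued rather than halted by stopping criteria or user-imposed caps on memory and iteration count. *)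

(* Defs.v *)
From mathcomp Require Import all_boot all_order all_algebra.
(* mpoly has to be imported before any file of MathComp-Analysis that declares
   topological notations; the converse order is rejected by the parser. *)
From mathcomp Require Import mpoly.
From mathcomp Require Import all_classical reals topology.

Set Implicit Arguments.
Unset Strict Implicit.
Unset Printing Implicit Defensive.

Import Order.TTheory GRing.Theory Num.Theory.
Import numFieldTopology.Exports.

Local Open Scope ring_scope.

(* Points of R^l are row vectors x : 'rV[R]_l; the function x 0 : 'I_l -> R
   lists the coordinates, so p evaluated at x is p.@[x 0]. *)

Section Boxes.
Variables (R : realType) (l : nat).

Record box := Box {
  lo : 'rV[R]_l;
  hi : 'rV[R]_l;
  box_ltP : forall mu : 'I_l, lo 0 mu < hi 0 mu }.

Definition box_set (u : box) : set 'rV[R]_l :=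
  [set x : 'rV[R]_l | forall mu : 'I_l, lo u 0 mu <= x 0 mu <= hi u 0 mu]%classic.

Definition box_boundary (u : box) : set 'rV[R]_l :=
  (closure (box_set u) `\` interior (box_set u))%classic.

Lemma unit_box_ltP (mu : 'I_l) :
  (const_mx 0 : 'rV[R]_l) 0 mu < (const_mx 1 : 'rV[R]_l) 0 mu.
Proof. by rewrite !mxE ltr01. Qed.

Definition unit_box : box := Box unit_box_ltP.

Definition set_coord (v : 'rV[R]_l) (r : 'I_l) (a : R) : 'rV[R]_l :=
  \row_mu (if mu == r then a else v 0 mu).

Definition midpoint (u : box) (r : 'I_l) : R := (lo u 0 r + hi u 0 r) / 2.

Lemma lower_half_ltP (u : box) (r mu : 'I_l) :
  lo u 0 mu < set_coord (hi u) r (midpoint u r) 0 mu.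
Proof.
rewrite mxE; case: eqP => [->|_]; last exact: box_ltP.
by rewrite (midf_lt (box_ltP u r)).1.
Qed.

Lemma upper_half_ltP (u : box) (r mu : 'I_l) :
  set_coord (lo u) r (midpoint u r) 0 mu < hi u 0 mu.
Proof.
rewrite mxE; case: eqP => [->|_]; last exact: box_ltP.
by rewrite (midf_lt (box_ltP u r)).2.
Qed.

Definition lower_half (u : box) (r : 'I_l) : box := Box (lower_half_ltP u r).
Definition upper_half (u : box) (r : 'I_l) : box := Box (upper_half_ltP u r).

End Boxes.

Section Bernstein.
Variables (R : realType) (l : nat) (p : {mpoly R[l]}).

Definition multideg (mu : 'I_l) : nat := \max_(m <- msupp p) m mu.

(* The multi-indices J with 0 <= J <= N, for N the multi-degree of p. *)
Definition bindex := {dffun forall mu : 'I_l, 'I_(multideg mu).+1}.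

Definition bindex0 : bindex := [ffun mu => ord0].

Definition bernstein (u : box R l) (J : bindex) (x : 'rV[R]_l) : R :=
  \prod_(mu < l)
    ('C(multideg mu, J mu)%:R *
     ((x 0 mu - lo u 0 mu) ^+ J mu *
      (hi u 0 mu - x 0 mu) ^+ (multideg mu - J mu) /
      (hi u 0 mu - lo u 0 mu) ^+ multideg mu)).

Definition is_patch (u : box R l) (B : {ffun bindex -> R}) : Prop :=
  forall x : 'rV[R]_l, p.@[x 0] = \sum_(J : bindex) B J * bernstein u J x.

(* The array of Bernstein coefficients over u. Since the polynomials
   [bernstein u J] form a basis of the polynomials of multi-degree at most N,
   exactly one array satisfies [is_patch u]; the default 0 is never used. *)
Definition patch (u : box R l) : {ffun bindex -> R} :=
  xget [ffun _ => 0] [set B | is_patch u B]%classic.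

(* The neutral elements of the iterated min and max below are themselves among
   the values ranged over, hence they do not affect the result. *)
Definition minB (u : box R l) : R :=
  \big[Num.min/patch u bindex0]_(J : bindex) patch u J.

Definition maxB (u : box R l) : R :=
  \big[Num.max/patch u bindex0]_(J : bindex) patch u J.

Definition is_minimizer (u : box R l) (x : 'rV[R]_l) : Prop :=
  box_set u x /\ forall y : 'rV[R]_l, box_set u y -> p.@[x 0] <= p.@[y 0].

Definition hessian (x : 'rV[R]_l) : 'M[R]_l :=
  \matrix_(i, j) (mderiv i (mderiv j p)).@[x 0].

End Bernstein.

(* Used for symmetric matrices only. *)
Definition posdef (R : realType) (l : nat) (A : 'M[R]_l) : Prop :=
  forall v : 'rV[R]_l, v != 0 -> 0 < (v *m A *m v^T) 0 0.

Section PCBA.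
Variables (R : realType) (l : nat) (p : {mpoly R[l]}).

(* The list of boxes kept by the algorithm; the patches need not be stored
   since the patch of a box is a function of the box. *)

Definition bisect (r : 'I_l) (L : seq (box R l)) : seq (box R l) :=
  flatten [seq [:: lower_half x r; upper_half x r] | x <- L].

(* min of [maxB p] over the nonempty list x :: L. *)
Definition p_up (x : box R l) (L : seq (box R l)) : R :=
  \big[Num.min/maxB p x]_(y <- L) maxB p y.

Definition cutoff (L : seq (box R l)) : seq (box R l) :=
  if L is x :: L' then [seq y <- L | ~~ (p_up x L' < minB p y)] else [::].

Definition pcba_iteration (L : seq (box R l)) : seq (box R l) :=
  foldl (fun L r => cutoff (bisect r L)) L (enum 'I_l).

Definition pcba (u : box R l) (n : nat) : seq (box R l) :=
  iter n pcba_iteration [:: u].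

End PCBA.

(* Main.v *)
Require Import Defs.
From mathcomp Require Import all_boot all_order all_algebra.
From mathcomp Require Import mpoly.
From mathcomp Require Import reals.
From mathcomp Require Import all_classical topology normedtype derive.
From mathcomp Require Import ring lra.
Import Defs.

Set Implicit Arguments.
Unset Strict Implicit.
Unset Printing Implicit Defensive.

Import Order.TTheory GRing.Theory Num.Theory.
Import numFieldTopology.Exports numFieldNormedType.Exports.

Local Open Scope ring_scope.

(** Why the number of boxes stays bounded.  After [n] iterations all surviving
    boxes are dyadic cubes of width h = 2^-n, so it is enough to show that each
    of them lies within distance O(h) of some minimizer: a ball of radius O(h)
    contains O(1) dyadic cubes of width h.

    Two estimates of order h^2 are played against each other.

    - Bernstein coefficients are quadratically close to values of [p]: over a
      cube of width h, the coefficient of index J differs by O(h^2) from the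
      value of [p] at the grid point J / N of that cube ([patch_grid]).  The
      gradient of [p] vanishes at an interior minimizer x0, so [p] exceeds its
      minimum by O(h^2) on the cube around x0, and so does [maxB]
      ([maxB_near_min]).  The cube around x0 is never cut off, because its
      [minB] is at most the minimum of [p].  Hence the cut-off threshold is at
      most p(x0) + O(h^2), and each surviving cube has [minB] below this value;
      it therefore contains a point z with p(z) - p(x0) = O(h^2).

    - Positive definite Hessians and compactness of the unit box give a
      constant c > 0 such that every z of the unit box satisfies
      c |z - x|^2 <= p(z) - p(x) for some minimizer x ([quadratic_growth]).

    Together they give |z - x| = O(h).

    The quadratic closeness rests on explicit Bernstein coefficients: those of
    a monomial over a box are known in closed form and factor over the
    coordinates ([bernstein_coef]).  They are the only ones, by a dual basis
    made of point evaluations ([is_patch_inj]), so [patch] is that closed form.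
    The quadratic growth rests on a second order Taylor estimate, obtained
    by induction on [p] from the Leibniz rule for the directional derivation
    ([taylor2]). *)

(** * Univariate Bernstein coefficients *)

Section Univariate.
Variable R : realType.
Implicit Types (a h s r x y : R) (n k i j : nat).

Lemma bin_shift i d e : (e <= d)%N ->
  ('C(i + e, i) * 'C(i + d, i + e) = 'C(i + d, i) * 'C(d, e))%N.
Proof.
move=> le_ed.
have ie := bin_fact (leq_addr e i); rewrite addKn in ie.
have ide : (i + e <= i + d)%N by rewrite leq_add2l.
have := bin_fact ide; rewrite subnDl => ied.
have id := bin_fact (leq_addr d i); rewrite addKn in id.
have de := bin_fact le_ed.
apply/eqP; rewrite -(eqn_pmul2r (fact_gt0 (d - e))).
rewrite -(eqn_pmul2r (fact_gt0 e)) -(eqn_pmul2r (fact_gt0 i)); apply/eqP.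
transitivity (i + d)`!; first by rewrite -ied -ie; ring.
by rewrite -id -de; ring.
Qed.

(** Binomially expand the factor (s + r)^(n - i) and absorb the binomial
    coefficients with [bin_shift].  For s = x - a and r = a + h - x it is the
    expansion of ((x - a) / h)^i in the Bernstein basis, with denominators
    cleared. *)
Lemma bernstein_power s r n i : (i <= n)%N ->
  s ^+ i * (s + r) ^+ (n - i) =
  \sum_(j < n.+1) ('C(j, i)%:R / 'C(n, i)%:R) *
    ('C(n, j)%:R * (s ^+ j * r ^+ (n - j))).
Proof.
move=> le_in; have [d ->] : exists d, n = (i + d)%N.
  by exists (n - i)%N; rewrite subnKC.
rewrite addKn -addnS big_split_ord /= big1 ?add0r; last first.
  by move=> j _; rewrite bin_small // !mul0r.
rewrite addrC exprDn mulr_sumr; apply: eq_bigr => -[e le_ed] _ /=.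
rewrite subnDl -mulrnAr -mulr_natl exprD.
have bin_neq0 : 'C(i + d, i)%:R != 0 :> R.
  by rewrite pnatr_eq0 -lt0n bin_gt0 leq_addr.
have /(congr1 (fun n => n%:R : R)) := bin_shift i (ltnSE le_ed).
rewrite !natrM => /esym/(canRL (mulKf bin_neq0)) ->.
by field.
Qed.

(** The [j]-th Bernstein coefficient of degree [n] of the power [x ^+ k] over
    the interval [[a, a + h]]: the Taylor expansion of the power at [a], in
    which each ((x - a) / h)^i is replaced by its own coefficient. *)
Definition bcoef a h n k j : R :=
  \sum_(i < k.+1) 'C(k, i)%:R * a ^+ (k - i) * h ^+ i *
    ('C(j, i)%:R / 'C(n, i)%:R).

Lemma bcoefP a h n k x : h != 0 -> (k <= n)%N ->
  x ^+ k = \sum_(j < n.+1) bcoef a h n k j *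
    ('C(n, j)%:R * ((x - a) ^+ j * (a + h - x) ^+ (n - j) / h ^+ n)).
Proof.
move=> h0 le_kn; rewrite -[x in LHS](subrKC a) exprDn.
under [RHS]eq_bigr do rewrite mulr_suml.
rewrite exchange_big /=; apply: eq_bigr => -[i le_ik] _ /=.
have le_in := leq_trans (ltnSE le_ik) le_kn.
have := bernstein_power (x - a) (a + h - x) le_in.
have -> : x - a + (a + h - x) = h by ring.
move=> /(canRL (mulfK (expf_neq0 _ h0))) ->.
rewrite -mulrnAl -mulr_natl mulr_suml mulr_sumr; apply: eq_bigr => j _.
have -> : h ^+ n = h ^+ i * h ^+ (n - i) by rewrite -exprD subnKC.
by field; rewrite !expf_neq0 // pnatr_eq0 -lt0n bin_gt0 le_in.
Qed.

(** The Bernstein basis has a dual basis of linear combinations of point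
    evaluations.  At n + 1 distinct nodes [t], the matrix of values of the
    powers is a Vandermonde matrix; by [bcoefP] it factors through the matrix
    [B] of values of the Bernstein polynomials, which is therefore invertible,
    and the weights are the columns of its inverse. *)
Lemma bernstein_dual a h n (j : 'I_n.+1) : h != 0 ->
  exists w t : 'I_n.+1 -> R, forall j' : 'I_n.+1,
    \sum_k w k * ('C(n, j')%:R *
      ((t k - a) ^+ j' * (a + h - t k) ^+ (n - j') / h ^+ n)) = (j' == j)%:R.
Proof.
move=> h0; pose t (k : 'I_n.+1) : R := k%:R.
pose B : 'M[R]_n.+1 := \matrix_(j', k) ('C(n, j')%:R *
      ((t k - a) ^+ j' * (a + h - t k) ^+ (n - j') / h ^+ n)).
pose A : 'M[R]_n.+1 := \matrix_(i, j') bcoef a h n i j'.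
have VE : Vandermonde n.+1 (\row_k t k) = A *m B.
  apply/matrixP => i k; rewrite !mxE (bcoefP a _ h0 (ltnSE (ltn_ord i))).
  by apply: eq_bigr => j' _; rewrite !mxE.
have : A *m B \in unitmx.
  rewrite -VE unitmxE det_Vandermonde unitfE.
  apply/prodf_neq0 => i _; apply/prodf_neq0 => k lt_ik.
  by rewrite !mxE subr_eq0 eqr_nat gtn_eqF.
rewrite unitmx_mul => /andP[_ uB].
exists (fun k : 'I_n.+1 => invmx B k j), t => j'.
have /matrixP/(_ j' j) := mulmxV uB; rewrite !mxE => <-.
by apply: eq_bigr => k _; rewrite [B j' k]mxE mulrC.
Qed.

(** Both numbers are combinations, with the same nonnegative weights of sum at
    most 2^k, of h^i times C(j, i) / C(n, i) and of h^i times (j / n)^i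
    respectively.  These ratios agree for i = 0 and i = 1, hence the difference
    only involves h^i with i >= 2. *)
Lemma bcoef_grid a h n k j : 0 <= a <= 1 -> 0 <= h <= 1 ->
    (k <= n)%N -> (j <= n)%N ->
  [/\ `|bcoef a h n k j| <= 2 ^+ k,
      `|(a + h * (j%:R / n%:R)) ^+ k| <= 2 ^+ k &
      `|bcoef a h n k j - (a + h * (j%:R / n%:R)) ^+ k| <= 2 ^+ k * h ^+ 2].
Proof.
move=> /andP[a0 a1] /andP[h0 h1] le_kn le_jn.
have two : 2 ^+ k = \sum_(i < k.+1) ('C(k, i)%:R : R).
  rewrite -[2]/(1 + 1)%R exprDn; apply: eq_bigr => i _.
  by rewrite !expr1n mulr1.
have q01 : 0 <= (j%:R / n%:R : R) <= 1.
  rewrite divr_ge0 //=; case: n le_kn le_jn => [|n] _ le_jn.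
    by rewrite invr0 mulr0.
  by rewrite ler_pdivrMr // mul1r ler_nat.
have f01 i : (i <= n)%N -> 0 <= ('C(j, i)%:R / 'C(n, i)%:R : R) <= 1.
  move=> le_in; rewrite divr_ge0 //= ler_pdivrMr ?ltr0n ?bin_gt0 //.
  by rewrite mul1r ler_nat leq_bin2l.
have p01 (y : R) i : 0 <= y <= 1 -> 0 <= y ^+ i <= 1.
  by move=> /andP[y0 y1]; rewrite exprn_ge0 // exprn_ile1.
have -> : (a + h * (j%:R / n%:R)) ^+ k =
    \sum_(i < k.+1) 'C(k, i)%:R * a ^+ (k - i) * h ^+ i * (j%:R / n%:R) ^+ i.
  rewrite exprDn; apply: eq_bigr => i _.
  by rewrite exprMn -mulr_natl !mulrA.
have bnd (G : nat -> R) (e : R) : 0 <= e ->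
   (forall i, (i <= k)%N -> `|h ^+ i * G i| <= e) ->
   `|\sum_(i < k.+1) 'C(k, i)%:R * a ^+ (k - i) * h ^+ i * G i| <= 2 ^+ k * e.
  move=> e0 Ge; rewrite two mulr_suml; apply: le_trans (ler_norm_sum _ _ _) _.
  apply: ler_sum => i _; rewrite -!mulrA normrM ger0_norm //.
  apply: ler_wpM2l => //; rewrite normrM ger0_norm ?exprn_ge0 //.
  rewrite -[e]mul1r ler_pM ?exprn_ge0 ?exprn_ile1 //.
  exact/Ge/ltnSE/ltn_ord.
split.
- rewrite -[2 ^+ k]mulr1.
  apply: (bnd (fun i => 'C(j, i)%:R / 'C(n, i)%:R)) => //.
  move=> i le_ik; have /andP[? ?] := f01 i (leq_trans le_ik le_kn).
  rewrite ger0_norm; last by rewrite mulr_ge0 ?exprn_ge0.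
  by apply: mulr_ile1 => //; rewrite ?exprn_ge0 ?exprn_ile1.
- rewrite -[2 ^+ k]mulr1; apply: (bnd (fun i => (j%:R / n%:R) ^+ i)) => //.
  move=> i le_ik; have /andP[? ?] := p01 _ i q01.
  rewrite ger0_norm; last by rewrite mulr_ge0 // exprn_ge0.
  by apply: mulr_ile1 => //; rewrite ?(exprn_ge0 _ h0) ?exprn_ile1.
- rewrite /bcoef -sumrB; under eq_bigr do rewrite -mulrBr.
  apply: (bnd (fun i => 'C(j, i)%:R / 'C(n, i)%:R - (j%:R / n%:R) ^+ i)).
    exact: exprn_ge0.
  move=> [|[|i]] le_ik.
  + by rewrite !bin0 divr1 expr0 subrr mulr0 normr0 exprn_ge0.
  + by rewrite !bin1 expr1 subrr mulr0 normr0 exprn_ge0.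
  + have /andP[f0 f1] := f01 i.+2 (leq_trans le_ik le_kn).
    have /andP[q0 q1] := p01 _ i.+2 q01.
    rewrite -addn2 exprD mulrAC -[leRHS]mul1r normrM.
    rewrite ler_pM // ?[`|_ ^+ 2|]ger0_norm ?exprn_ge0 //.
    rewrite normrM mulr_ile1 //.
      by rewrite ger0_norm ?exprn_ge0 // exprn_ile1.
    by rewrite addn2 ler_norml; lra.
Qed.

End Univariate.


(** * The Bernstein patch of a polynomial *)

(** The dependent version of [bigA_distr_bigA]: the index ranges of the factors
    may differ, as do the degrees of a polynomial in its different variables. *)
Lemma prod_sum_dffun (A : comPzSemiRingType) (I : finType) (T : I -> finType)
    (F : forall i, T i -> A) :
  \prod_i \sum_(j : T i) F i j =
  \sum_(J : {dffun forall i, T i}) \prod_i F i (J i).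
Proof.
rewrite (reindex (@dffun_of_fprod _ T)); last first.
  exact/onW_bij/dffun_of_fprod_bij.
transitivity (\sum_(t : fprod T) \prod_(i in I) [ffun j => F i j] (t i)).
  pose G i : {i & T i} -> A := untag 0 [ffun j => F i j].
  rewrite big_fprod -/(G _) -(bigA_distr_big_dep (tagged_with T) G).
  apply: eq_bigr => i _.
  rewrite -(big_tag (fun i => [ffun j => F i j] : T i -> A)).
  by apply: eq_bigr => j _; rewrite ffunE.
by apply: eq_bigr => t _; apply: eq_bigr => i _; rewrite !ffunE.
Qed.

(** Telescoping: replace the factors one at a time.  Measuring the error of
    each factor relative to its bound [M i] keeps the induction free of any
    assumption that the bounds exceed 1. *)
Lemma prod_diff_le (R : realType) (I : Type) (s : seq I) (a b M : I -> R)
    (e : R) :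
    0 <= e ->
    (forall i, [/\ `|a i| <= M i, `|b i| <= M i & `|a i - b i| <= M i * e]) ->
  `|\prod_(i <- s) a i - \prod_(i <- s) b i| <=
    \prod_(i <- s) M i * (size s)%:R * e.
Proof.
move=> e0 abM; have M0 i : 0 <= M i.
  by have [/(le_trans (normr_ge0 _))] := abM i.
elim: s => [|i s IHs]; first by rewrite !big_nil subrr normr0 mulr0 mul0r.
rewrite !big_cons /=; set A := \prod_(i <- s) a i in IHs *.
set B := \prod_(i <- s) b i in IHs *; set P := \prod_(i <- s) M i in IHs *.
have BP : `|B| <= P.
  rewrite /B /P normr_prod; apply: ler_prod => j _.
  by rewrite normr_ge0; have [] := abM j.
have [ai bi abi] := abM i.
have -> : a i * A - b i * B = a i * (A - B) + (a i - b i) * B by ring.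
apply: le_trans (ler_normD _ _) _; rewrite !normrM.
apply: le_trans (lerD (ler_pM _ _ ai IHs) (ler_pM _ _ abi BP)) _ => //.
by rewrite -natr1 le_eqVlt; apply/orP; left; apply/eqP; ring.
Qed.

Section Patch.
Variables (R : realType) (l : nat) (p : {mpoly R[l]}).
Implicit Types (u : box R l) (x z : 'rV[R]_l) (J : bindex p).

Let width u mu := hi u 0 mu - lo u 0 mu.

Let width_neq0 u mu : width u mu != 0.
Proof. by rewrite subr_eq0 gt_eqF // box_ltP. Qed.

Let factor u mu (j : nat) (y : R) : R :=
  'C(multideg p mu, j)%:R * ((y - lo u 0 mu) ^+ j *
    (lo u 0 mu + width u mu - y) ^+ (multideg p mu - j) /
    width u mu ^+ multideg p mu).

Let bernsteinE u J x :
  bernstein u J x = \prod_mu factor u mu (J mu) (x 0 mu).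
Proof. by apply: eq_bigr => mu _; rewrite /factor /width subrKC. Qed.

Lemma msupp_multideg (m : 'X_{1..l}) mu :
  m \in msupp p -> (m mu <= multideg p mu)%N.
Proof. by move=> m_p; apply: leq_bigmax_seq. Qed.

(** The closed form of the patch: the Bernstein coefficients of a monomial over
    a box are products of univariate ones. *)
Definition bernstein_coef u : {ffun bindex p -> R} :=
  [ffun J : bindex p => \sum_(m <- msupp p) p@_m *
     \prod_mu bcoef (lo u 0 mu) (hi u 0 mu - lo u 0 mu)
                    (multideg p mu) (m mu) (J mu)].

Lemma bernstein_coef_patch u : is_patch u (bernstein_coef u).
Proof.
move=> x; rewrite mevalE; under [RHS]eq_bigr do rewrite ffunE mulr_suml.
rewrite exchange_big /=; rewrite !big_seq; apply: eq_bigr => m m_p.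
under [RHS]eq_bigr do rewrite -mulrA.
rewrite -mulr_sumr; congr (_ * _).
under eq_bigr => mu _ do
  rewrite (bcoefP (lo u 0 mu) _ (width_neq0 u mu) (msupp_multideg mu m_p)).
rewrite (@prod_sum_dffun R); apply: eq_bigr => J _.
by rewrite bernsteinE -big_split.
Qed.

(** Tensor products of the univariate dual functionals extract the coefficient
    of index [J] of an expansion in the Bernstein basis. *)
Lemma is_patch_inj u (B B' : {ffun bindex p -> R}) :
  is_patch u B -> is_patch u B' -> B = B'.
Proof.
move=> BP BP'; apply/ffunP => J; apply/eqP; rewrite -subr_eq0; apply/eqP.
pose D (J' : bindex p) := B J' - B' J'; rewrite -/(D J).
have D0 x : \sum_(J' : bindex p) D J' * bernstein u J' x = 0.
  under eq_bigr do rewrite mulrBl.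
  by rewrite sumrB -BP -BP' subrr.
have dual mu := @bernstein_dual R (lo u 0 mu) _ _ (J mu) (width_neq0 u mu).
pose w mu := sval (cid (dual mu)).
pose t mu := sval (cid (svalP (cid (dual mu)))).
have wt mu (j : 'I_(multideg p mu).+1) :
    \sum_k w mu k * factor u mu j (t mu k) = (j == J mu)%:R.
  exact: svalP (cid (svalP (cid (dual mu)))) j.
have sumK (J' : bindex p) :
    \sum_(K : bindex p) (\prod_mu w mu (K mu)) *
      (D J' * bernstein u J' (\row_mu t mu (K mu))) =
    D J' * \prod_mu (J' mu == J mu)%:R.
  under [LHS]eq_bigr => K _ do rewrite mulrCA bernsteinE -big_split /=.
  rewrite -mulr_sumr; congr (_ * _).
  under [LHS]eq_bigr => K _ do under eq_bigr => mu _ do rewrite mxE.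
  rewrite -(@prod_sum_dffun R _ _
    (fun mu k => w mu k * factor u mu (J' mu) (t mu k))).
  by apply: eq_bigr => mu _.
transitivity (\sum_(K : bindex p) (\prod_mu w mu (K mu)) *
    \sum_(J' : bindex p) D J' * bernstein u J' (\row_mu t mu (K mu)));
  last by apply: big1 => K _; rewrite D0 mulr0.
under eq_bigr do rewrite mulr_sumr.
rewrite exchange_big /=; under eq_bigr do rewrite sumK.
rewrite (bigD1 J) //= big1 => [|mu _]; last by rewrite eqxx.
rewrite mulr1 big1 ?addr0 // => J' J'J.
have [mu J'Jmu] : exists mu, J' mu != J mu.
  apply/existsP; apply: contraR J'J; rewrite negb_exists => /forallP eqJ.
  by apply/eqP/ffunP => mu; have /negPn/eqP := eqJ mu.
by rewrite (bigD1 mu) //= (negbTE J'Jmu) mul0r mulr0.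
Qed.

Lemma patchE u : patch p u = bernstein_coef u.
Proof.
apply: xget_unique => [|B BP] /=; first exact: bernstein_coef_patch.
exact: is_patch_inj BP (bernstein_coef_patch u).
Qed.

Lemma sum_bernstein u x : \sum_(J : bindex p) bernstein u J x = 1.
Proof.
under eq_bigr do rewrite bernsteinE.
rewrite -(@prod_sum_dffun R _ _ (fun mu (j : 'I_(multideg p mu).+1) =>
    factor u mu j (x 0 mu))).
apply: big1 => mu _.
rewrite -[RHS](expr0 (x 0 mu)).
rewrite (bcoefP (lo u 0 mu) _ (width_neq0 u mu) (leq0n (multideg p mu))).
apply: eq_bigr => j _; rewrite -[LHS]mul1r; congr (_ * _).
by rewrite /bcoef big_ord1 !bin0 !expr0 divr1 !mulr1.
Qed.

Lemma bernstein_ge0 u J x : box_set u x -> 0 <= bernstein u J x.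
Proof.
move=> ux; apply: prodr_ge0 => mu _; have /andP[lox xhi] := ux mu.
have := box_ltP u mu; move=> /ltW lohi.
by rewrite !(mulr_ge0, exprn_ge0, invr_ge0, subr_ge0).
Qed.

Lemma minB_le_patch u J : minB p u <= patch p u J.
Proof. exact: bigmin_le_cond. Qed.

Lemma patch_le_maxB u J : patch p u J <= maxB p u.
Proof. exact: le_bigmax_cond. Qed.

Lemma minB_attained u : exists J, minB p u = patch p u J.
Proof.
rewrite /minB; elim/big_ind: _ => [|y z [J ->] [J' ->]|J _]; last by exists J.
  by exists (bindex0 p).
by rewrite /Order.min; case: ifP; eexists.
Qed.

Lemma maxB_attained u : exists J, maxB p u = patch p u J.
Proof.
rewrite /maxB; elim/big_ind: _ => [|y z [J ->] [J' ->]|J _]; last by exists J.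
  by exists (bindex0 p).
by rewrite /Order.max; case: ifP; eexists.
Qed.

(** The Bernstein polynomials are nonnegative on the box and add up to 1, so
    the values of [p] are convex combinations of the coefficients. *)
Lemma patch_hull u x : box_set u x -> minB p u <= p.@[x 0] <= maxB p u.
Proof.
move=> ux; rewrite (bernstein_coef_patch u x) -patchE.
apply/andP; split.
  rewrite -[leLHS]mulr1 -(sum_bernstein u x) mulr_sumr; apply: ler_sum => J _.
  by rewrite ler_wpM2r ?bernstein_ge0 ?minB_le_patch.
rewrite -[leRHS]mulr1 -(sum_bernstein u x) mulr_sumr; apply: ler_sum => J _.
by rewrite ler_wpM2r ?bernstein_ge0 ?patch_le_maxB.
Qed.

(** Apply [bcoef_grid] in each variable of each monomial; the point [z] is the
    grid point of index J / N, whose [mu]-th coordinate is the lower end of the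
    box when the degree in [mu] is 0. *)
Lemma patch_grid : exists2 D : R, 0 <= D &
  forall u (h : R), 0 < h <= 1 ->
    (forall mu, 0 <= lo u 0 mu <= 1 /\ hi u 0 mu = lo u 0 mu + h) ->
  forall J, exists2 z, box_set u z & `|patch p u J - p.@[z 0]| <= D * h ^+ 2.
Proof.
exists (\sum_(m <- msupp p) `|p@_m| * (\prod_(mu < l) 2 ^+ m mu * l%:R)).
  apply: sumr_ge0 => m _; rewrite !mulr_ge0 //.
  by apply: prodr_ge0 => mu _; rewrite exprn_ge0.
move=> u h /andP[h0 h1] uh J.
have h01 : 0 <= h <= 1 by rewrite ltW.
exists (\row_mu (lo u 0 mu + h * ((J mu)%:R / (multideg p mu)%:R))).
  move=> mu; rewrite mxE; have [_ ->] := uh mu.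
  rewrite lerDl lerD2l mulr_ge0 ?(ltW h0) ?divr_ge0 //=.
  rewrite ler_piMr ?(ltW h0) //.
  have := ltn_ord (J mu); rewrite ltnS.
  case: (multideg p mu) (nat_of_ord (J mu)) => [|n] j le_jn.
    by rewrite invr0 mulr0.
  by rewrite ler_pdivrMr ?mul1r ?ler_nat ?ltr0n.
rewrite patchE ffunE mevalE -sumrB mulr_suml.
apply: le_trans (ler_norm_sum _ _ _) _.
rewrite !big_seq; apply: ler_sum => m m_p.
rewrite -mulrBr normrM -mulrA ler_wpM2l //.
under [X in _ - X]eq_bigr do rewrite mxE.
have := @prod_diff_le R _ (enum 'I_l)
  (fun mu => bcoef (lo u 0 mu) (hi u 0 mu - lo u 0 mu)
                   (multideg p mu) (m mu) (J mu))
  (fun mu => (lo u 0 mu + h * ((J mu)%:R / (multideg p mu)%:R)) ^+ m mu)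
  (fun mu => 2 ^+ m mu) (h ^+ 2).
rewrite !big_enum /= -cardE card_ord; apply; first by rewrite exprn_ge0 // ltW.
move=> mu; have [lo01 ->] := uh mu; rewrite addrAC subrr add0r.
by apply: bcoef_grid => //; [exact: msupp_multideg|rewrite -ltnS].
Qed.

End Patch.

(** * Second order Taylor expansion of multivariate polynomials *)

Section Taylor.
Variables (R : realType) (l : nat).
Implicit Types (p q : {mpoly R[l]}) (x v : 'rV[R]_l) (c : R).

(** The derivative in direction [v] is kept as a derivation of the polynomial
    ring, so that second derivatives of products come from the Leibniz rule
    and no double sum over coordinates has to be expanded. *)
Definition dirder v p : {mpoly R[l]} := \sum_i v 0 i *: p^`M(i).

Lemma dirderD v p q : dirder v (p + q) = dirder v p + dirder v q.
Proof.
by rewrite -big_split; apply: eq_bigr => i _ /=; rewrite mderivD scalerDr.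
Qed.

Lemma dirderZ v c p : dirder v (c *: p) = c *: dirder v p.
Proof.
rewrite scaler_sumr; apply: eq_bigr => i _.
by rewrite mderivZ !scalerA mulrC.
Qed.

Lemma dirderM v p q : dirder v (p * q) = dirder v p * q + p * dirder v q.
Proof.
rewrite mulr_suml mulr_sumr -big_split; apply: eq_bigr => i _ /=.
by rewrite mderivM scalerDr scalerAl scalerAr.
Qed.

Lemma dirderC v c : dirder v c%:MP = 0.
Proof. by apply: big1 => i _; rewrite mderivC scaler0. Qed.

Lemma dirderX v i : dirder v 'X_i = (v 0 i)%:MP.
Proof.
rewrite /dirder (bigD1 i) //= big1 ?addr0 => [|j ji].
  have -> : 'X_i^`M(i) = 1 :> {mpoly R[l]}.
    by rewrite mderivX mnm1E eqxx scale1r -{1}[U_(i)%MM]add0m addmK mpolyX0.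
  by rewrite -mul_mpolyC mulr1.
by rewrite mderivX mnm1E eq_sym (negbTE ji) scale0r scaler0.
Qed.

Lemma dirder_scale t v p x :
  (dirder (t *: v) p).@[x 0] = t * (dirder v p).@[x 0].
Proof.
rewrite /dirder !raddf_sum mulr_sumr; apply: eq_bigr => i _ /=.
by rewrite !mevalZ mxE mulrA.
Qed.

Lemma dirder2_scale t v p x :
  (dirder (t *: v) (dirder (t *: v) p)).@[x 0] =
  t ^+ 2 * (dirder v (dirder v p)).@[x 0].
Proof.
have -> : dirder (t *: v) p = t *: dirder v p.
  by rewrite scaler_sumr; apply: eq_bigr => i _; rewrite mxE scalerA.
by rewrite dirder_scale dirderZ mevalZ mulrA expr2.
Qed.

Lemma hessianE p x v :
  (v *m hessian p x *m v^T) 0 0 = (dirder v (dirder v p)).@[x 0].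
Proof.
rewrite /dirder !raddf_sum mxE /=.
under [RHS]eq_bigr => i _ do
  rewrite mevalZ (linear_sum (mderiv i)) raddf_sum mulr_sumr /=.
rewrite [RHS]exchange_big /=; apply: eq_bigr => i _.
rewrite !mxE mulr_suml; apply: eq_bigr => j _.
by rewrite !mxE mderivZ mevalZ -mulrA [_ * v 0 i]mulrC.
Qed.

(** The bounds on the first and second order terms make the property stable
    under multiplication by a variable. *)
Definition taylor2_bound x p := exists2 K : R, 0 <= K &
  forall v, `|v| <= 1 ->
  [/\ `|(dirder v p).@[x 0]| <= K * `|v|,
      `|(dirder v (dirder v p)).@[x 0]| <= K * `|v| ^+ 2 &
      `|p.@[(x + v) 0] - p.@[x 0] - (dirder v p).@[x 0]
        - (dirder v (dirder v p)).@[x 0] / 2| <= K * `|v| ^+ 3].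

Lemma coord_le_norm v i : `|v 0 i| <= `|v|.
Proof.
rewrite [leRHS]/Num.norm /= mx_normrE.
by apply/bigmax_geP; right; exists (0, i).
Qed.

Lemma taylor2_boundC x c : taylor2_bound x c%:MP.
Proof.
exists 0 => // v _; rewrite dirderC -mpolyC0 dirderC mpolyC0 meval0 !mevalC.
by rewrite normr0 !mul0r !subrr normr0.
Qed.

Lemma taylor2_boundD x p q :
  taylor2_bound x p -> taylor2_bound x q -> taylor2_bound x (p + q).
Proof.
move=> [K K0 pK] [M M0 qM]; exists (K + M); first exact: addr_ge0.
move=> v v1; have [p1 p2 p3] := pK v v1; have [q1 q2 q3] := qM v v1.
rewrite !dirderD !mevalD !mulrDl.
split; do ?by apply: le_trans (ler_normD _ _) (lerD _ _).
apply: le_trans (lerD p3 q3); apply: le_trans (ler_normD _ _).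
by rewrite le_eqVlt; apply/orP; left; apply/eqP; congr `|_|; ring.
Qed.

Lemma taylor2_boundZ x c p : taylor2_bound x p -> taylor2_bound x (c *: p).
Proof.
move=> [K K0 pK]; exists (`|c| * K); first exact: mulr_ge0.
move=> v v1; have [p1 p2 p3] := pK v v1.
rewrite !dirderZ !mevalZ.
have -> : c * p.@[(x + v) 0] - c * p.@[x 0] - c * (dirder v p).@[x 0]
   - c * (dirder v (dirder v p)).@[x 0] / 2 =
  c * (p.@[(x + v) 0] - p.@[x 0] - (dirder v p).@[x 0]
        - (dirder v (dirder v p)).@[x 0] / 2) by ring.
by rewrite ![`|c * _|]normrM -!mulrA; split; rewrite ler_wpM2l.
Qed.

(** Multiplication by a variable is the only product needed to reach all
    monomials.  The second derivative of 'X_i vanishes, so that the remainder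
    of the product is the old remainder times the value of 'X_i at x + v, plus
    the second order term of [p] times [v 0 i]. *)
Lemma taylor2_boundXM x i p : taylor2_bound x p -> taylor2_bound x ('X_i * p).
Proof.
move=> [K K0 pK]; exists (`|p.@[x 0]| + (`|x 0 i| + 2) * K).
  by rewrite addr_ge0 ?mulr_ge0 ?addr_ge0.
move=> v v1; have [p1 p2 p3] := pK v v1.
have -> : dirder v ('X_i * p) = (v 0 i)%:MP * p + 'X_i * dirder v p.
  by rewrite dirderM dirderX.
have -> : dirder v ((v 0 i)%:MP * p + 'X_i * dirder v p) =
    (v 0 i)%:MP * dirder v p *+ 2 + 'X_i * dirder v (dirder v p).
  by rewrite dirderD !dirderM dirderX dirderC; ring.
rewrite !(mevalD, mevalM, mevalMn, mevalC, mevalXU) mxE.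
set P := p.@[_] in p3 *; set p0 := p.@[_] in p3 *.
set d1 := meval _ _ in p1 p3 *; set d2 := meval _ _ in p2 p3 *.
set r := P - _ - _ - _ in p3; set a := x 0 i; set w := v 0 i.
have wv : `|w| <= `|v| := coord_le_norm v i.
have n0 : 0 <= `|v| := normr_ge0 v.
move: `|v| v1 p1 p2 p3 wv n0 => n n1 p1 p2 p3 wn n0.
have a0 := normr_ge0 a; have pp0 := normr_ge0 p0.
split.
- apply: le_trans (ler_normD _ _) _; rewrite !normrM.
  have := ler_wpM2r pp0 wn; have := ler_wpM2l a0 p1.
  have : 0 <= K * n by rewrite mulr_ge0.
  by nra.
- apply: le_trans (ler_normD _ _) _.
  apply: le_trans (lerD (ler_normD _ _) (lexx _)) _; rewrite !normrM.
  have := ler_pM (normr_ge0 _) (normr_ge0 _) wn p1.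
  have := ler_wpM2l a0 p2.
  have : 0 <= `|p0| * n ^+ 2 by rewrite mulr_ge0 ?exprn_ge0.
  by nra.
- have -> : (a + w) * P - a * p0 - (w * p0 + a * d1)
      - (w * d1 + w * d1 + a * d2) / 2 = a * r + w * r + w * d2 / 2.
    by rewrite /r; field.
  have aK := ler_wpM2l a0 p3.
  have wr := ler_pM (normr_ge0 _) (normr_ge0 _) (le_trans wn n1) p3.
  have wd := ler_pM (normr_ge0 _) (normr_ge0 _) wn p2.
  apply: le_trans (ler_normD _ _) _.
  rewrite [`|_ / 2|]normrM [`|2^-1|]ger0_norm ?invr_ge0 //.
  apply: le_trans (lerD (ler_normD _ _) (lexx _)) _; rewrite !normrM.
  have : 0 <= `|p0| * n ^+ 3 by rewrite mulr_ge0 ?exprn_ge0.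
  have : 0 <= K * n ^+ 3 by rewrite mulr_ge0 ?exprn_ge0.
  by rewrite !exprS expr0 in aK wr wd *; nra.
Qed.

Lemma taylor2 x p : taylor2_bound x p.
Proof.
elim/mpolyind: p => [|c m p _ _ IHp].
  by rewrite -mpolyC0; apply: taylor2_boundC.
apply: taylor2_boundD => //; apply: taylor2_boundZ; rewrite mpolyXE_id.
elim/big_rec: _ => [|i q _ IHq].
  by rewrite -mpolyC1; apply: taylor2_boundC.
elim: (m i) => [|k IHk]; first by rewrite mul1r.
by rewrite exprS -mulrA; apply: taylor2_boundXM.
Qed.

End Taylor.

(** * Quadratic growth around the minimizers *)

Section Growth.
Variables (R : realType) (l : nat) (p : {mpoly R[l]}).
Implicit Types (q : {mpoly R[l]}) (x y z v : 'rV[R]_l) (c : R).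

Lemma norm_le_coord v c : 0 <= c -> (forall i, `|v 0 i| <= c) -> `|v| <= c.
Proof.
move=> c0 vc; rewrite [leLHS]/Num.norm /= mx_normrE.
by apply/bigmax_leP; split=> // -[i j] _ /=; rewrite ord1.
Qed.

Lemma meval_continuous q : continuous (fun x => q.@[x 0]).
Proof.
move=> x; have [K K0 Kq] := taylor2 x q.
apply/(@cvgrPdist_le R R^o _ (nbhs x) (nbhs_filter x)
  (fun x => q.@[x 0])) => e e0.
pose d := Num.min 1 (e / (3 * K + 1)).
have K1 : 0 < 3 * K + 1 by lra.
have d0 : 0 < d by rewrite /d lt_min ltr01 divr_gt0.
apply/(@nbhs_normP R 'rV[R]_l); exists d => //= z.
rewrite /ball_ /= distrC => zd.
have := zd; rewrite /d lt_min ltr_pdivlMr // => /andP[/ltW z1 ze].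
have [] := Kq (z - x) z1; rewrite subrKC.
move: `|z - x| (normr_ge0 (z - x)) z1 ze => n n0 n1 ne.
rewrite !ler_norml => /andP[a1 a2] /andP[b1 b2] /andP[c1 c2].
have n2 : K * n ^+ 2 <= K * n by rewrite expr2 ler_wpM2l // ler_piMr.
have n3 : K * n ^+ 3 <= K * n.
  by rewrite exprS ler_wpM2l // ler_piMr // exprn_ile1.
by apply/andP; split; lra.
Qed.

Lemma compact_min_gt0 (K : set 'rV[R]_l) (f : 'rV[R]_l -> R) :
    compact K -> continuous f -> (forall x, K x -> 0 < f x) ->
  exists2 c, 0 < c & forall x, K x -> c <= f x.
Proof.
move=> cK cf f0.
have [K0|/set0P K_neq0] := eqVneq K set0.
  by exists 1 => // x; rewrite K0.
have [y /set_mem Ky yK] :=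
  compact_EVT_min K_neq0 cK (continuous_subspaceT cf).
by exists (f y); [exact: f0 | move=> x Kx; exact/yK/mem_set].
Qed.

(** The quadratic form of the Hessian has a positive minimum on the unit sphere,
    which is compact; the rest is homogeneity. *)
Lemma posdef_coercive x : posdef (hessian p x) ->
  exists2 c, 0 < c &
    forall v, c * `|v| ^+ 2 <= (dirder v (dirder v p)).@[x 0].
Proof.
move=> Hx; pose q : {mpoly R[l]} :=
  \sum_i \sum_j (hessian p x i j) *: ('X_i * 'X_j).
have qE v : q.@[v 0] = (dirder v (dirder v p)).@[x 0].
  rewrite -hessianE mxE raddf_sum /=.
  under [RHS]eq_bigr do rewrite !mxE mulr_suml.
  rewrite [RHS]exchange_big; apply: eq_bigr => i _ /=.
  rewrite raddf_sum; apply: eq_bigr => j _ /=.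
  by rewrite mevalZ mevalM !mevalXU; ring.
have sphere_compact : compact [set v : 'rV[R]_l | `|v| = 1]%classic.
  apply: bounded_closed_compact.
    by exists 1; split=> // M M1 v /= ->; exact: ltW.
  apply: (preimage_closed (f := fun v : 'rV[R]_l => `|v|)) (closed_eq (y := 1)).
  by move=> v _; exact: norm_continuous.
have q_gt0 v : `|v| = 1 -> 0 < q.@[v 0].
  by move=> v1; rewrite qE -hessianE; apply: Hx; rewrite -normr_gt0 v1.
have [c c0 cq] := compact_min_gt0 sphere_compact (@meval_continuous q) q_gt0.
exists c => // v; have [->|v0] := eqVneq v 0.
  rewrite normr0 expr0n mulr0 -(scale0r (0 : 'rV[R]_l)).
  by rewrite dirder2_scale expr0n mul0r.
have nv : `|v| != 0 by rewrite normr_eq0.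
have := cq (`|v|^-1 *: v); rewrite qE dirder2_scale /= normrZ normfV normr_id.
rewrite mulVf // => /(_ erefl).
by rewrite exprVn mulrC ler_pdivlMr // exprn_gt0 // normr_gt0.
Qed.

(** If the derivative in direction [v] were negative, a short step along [v]
    would decrease [p]; applying this to [- v] as well gives 0. *)
Lemma local_min_dirder0 x e : 0 < e ->
    (forall v, `|v| < e -> p.@[x 0] <= p.@[(x + v) 0]) ->
  forall v, (dirder v p).@[x 0] = 0.
Proof.
move=> e0 xmin.
have dge0 v : 0 <= (dirder v p).@[x 0].
  rewrite leNgt; apply/negP => dlt0; have [K K0 Kp] := taylor2 x p.
  (* The step [t] is small enough for [x + t *: v] to lie in the neighbourhood,
     for [t *: v] to have norm at most 1, and for the terms of order 2 and 3,
     at most 2 K (t |v|)^2, to be dominated by the first order term. *)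
  pose A := `|v| + 2 * K * `|v| ^+ 2.
  pose b := Num.min (Num.min e 1) (- (dirder v p).@[x 0]).
  have A0 : 0 <= A by rewrite addr_ge0 ?mulr_ge0 ?exprn_ge0.
  have b0 : 0 < b by rewrite !lt_min e0 ltr01 oppr_gt0.
  pose t := b / (A + 1).
  have t0 : 0 < t by rewrite divr_gt0 //; lra.
  have tA : t * A < b by rewrite /t mulrAC ltr_pdivrMr; nra.
  have [be b1 bd] : [/\ b <= e, b <= 1 & b <= - (dirder v p).@[x 0]].
    by rewrite /b !ge_min !lexx ?orbT.
  have v0 := normr_ge0 v.
  have Kv : 0 <= 2 * K * `|v| ^+ 2 by rewrite !mulr_ge0 ?exprn_ge0.
  have tv : t * `|v| <= t * A by rewrite ler_wpM2l ?(ltW t0) // lerDl.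
  have tvE : `|t *: v| = t * `|v| by rewrite normrZ gtr0_norm.
  have tv1 : `|t *: v| <= 1 by rewrite tvE; lra.
  have := xmin (t *: v); rewrite tvE => /(_ ltac:(lra)) pxt.
  have [_] := Kp _ tv1; rewrite dirder2_scale dirder_scale tvE.
  rewrite !ler_norml => /andP[c1 c2] /andP[d1 d2].
  have tKv : t * (2 * K * `|v| ^+ 2) <= t * A.
    by rewrite ler_wpM2l ?(ltW t0) // lerDr.
  rewrite tvE in tv1.
  have n3 : K * (t * `|v|) ^+ 3 <= K * (t * `|v|) ^+ 2.
    by rewrite ler_wpM2l // exprS ler_piMl // exprn_ge0 // mulr_ge0 // ltW.
  have K2 : 0 <= K * (t * `|v|) ^+ 2.
    by rewrite mulr_ge0 // exprn_ge0 // mulr_ge0 // ltW.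
  have : 0 <= t * ((dirder v p).@[x 0] + t * (2 * K * `|v| ^+ 2)).
    have -> : t * ((dirder v p).@[x 0] + t * (2 * K * `|v| ^+ 2)) =
      t * (dirder v p).@[x 0] + 2 * (K * (t * `|v|) ^+ 2) by ring.
    by lra.
  by rewrite pmulr_rge0 //; lra.
move=> v; apply/eqP; rewrite eq_le dge0 andbT -oppr_ge0 -mulN1r -dirder_scale.
exact: dge0.
Qed.

(** The first order term vanishes, the second order term is at least
    (c / 2) |v|^2 and the cubic remainder takes away at most half of it. *)
Lemma local_min_growth x e : 0 < e ->
    (forall v, `|v| < e -> p.@[x 0] <= p.@[(x + v) 0]) ->
    posdef (hessian p x) ->
  exists2 c, 0 < c & exists2 d, 0 < d &
    forall v, `|v| < d -> c * `|v| ^+ 2 <= p.@[(x + v) 0] - p.@[x 0].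
Proof.
move=> e0 xmin /posdef_coercive[c c0 cx].
have [K K0 Kp] := taylor2 x p; have K1 : 0 < K + 1 by lra.
exists (c / 4); first by rewrite divr_gt0.
exists (Num.min 1 (c / 4 / (K + 1))).
  by rewrite lt_min ltr01 !divr_gt0.
move=> v; rewrite lt_min => /andP[v1]; rewrite ltr_pdivlMr // => vK.
have [_ _] := Kp v (ltW v1).
rewrite (local_min_dirder0 e0 xmin) subr0 ler_norml => /andP[vp _].
have := cx v; move: vp vK v1 (normr_ge0 v).
move: `|v| (dirder _ _).@[_] => n d dp nK n1 n0 cd.
have : n * K * n ^+ 2 <= c / 4 * n ^+ 2.
  by rewrite ler_wpM2r ?exprn_ge0 //; nra.
have -> : n * K * n ^+ 2 = K * n ^+ 3 by ring.
by lra.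
Qed.

Lemma unit_box_compact : compact (box_set (unit_box R l)).
Proof.
have := @rV_compact R l (fun=> `[0, 1]%classic) (fun=> @segment_compact _ _ _).
congr compact; apply/seteqP; split=> x x01 i; have := x01 i => /=;
  by rewrite !mxE in_itv.
Qed.

Lemma interior_min x : is_minimizer p (unit_box R l) x ->
    ~ box_boundary (unit_box R l) x ->
  exists2 e : R, 0 < e & forall v, `|v| < e -> p.@[x 0] <= p.@[(x + v) 0].
Proof.
move=> [ux xmin] x_int.
have : interior (box_set (unit_box R l)) x.
  by apply: contrapT => Nint; apply: x_int; split=> //; exact: subset_closure.
move/nbhs_normP => [e /= e0 eu]; exists e => // v ve.
apply/xmin/eu; rewrite /ball_ /=.
by rewrite opprD addNKr normrN.
Qed.

(** The inequality holds locally with a constant that depends on the point: near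
    a minimizer by [local_min_growth], near any other point because [p] is
    bounded away from its minimum while distances in the unit box are at most
    1.  Compactness, in the form of [near_covering], makes the constant
    uniform. *)
Lemma quadratic_growth (I : Type) (xs : I -> 'rV[R]_l) :
    (forall x, is_minimizer p (unit_box R l) x <-> exists i, x = xs i) ->
    (forall i, ~ box_boundary (unit_box R l) (xs i)) ->
    (forall i, posdef (hessian p (xs i))) ->
  exists2 c, 0 < c & forall z, box_set (unit_box R l) z ->
    exists i, c * `|z - xs i| ^+ 2 <= p.@[z 0] - p.@[xs i 0].
Proof.
move=> xs_min xs_int xs_hess; set u := unit_box R l.
have xs_u i : is_minimizer p u (xs i) by apply/xs_min; exists i.
(* Points that are not minimizers are compared with some fixed minimizer,
   which exists since [p] attains its minimum on the unit box. *)
have [i0 _] : exists i : I, True.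
  have u_neq0 : (box_set u !=set0)%classic.
    by exists 0 => i; rewrite !mxE lexx ler01.
  have [y /set_mem uy ymin] := compact_EVT_min u_neq0 unit_box_compact
    (continuous_subspaceT (@meval_continuous p)).
  have /xs_min[i _] : is_minimizer p u y.
    by split=> // z uz; apply/ymin/mem_set.
  by exists i.
have := unit_box_compact => /compact_near_coveringP/near_covering_withinP cov.
suff /cov : forall y, box_set u y ->
    \forall z \near y & c \near at_right (0 : R), box_set u z ->
      exists i, c * `|z - xs i| ^+ 2 <= p.@[z 0] - p.@[xs i 0].
  move=> covc.
  have /filter_ex[c [c0 cP]] : \forall c \near at_right (0 : R), 0 < c /\
      (box_set u `<=` (fun z => exists i,
         c * `|z - xs i| ^+ 2 <= p.@[z 0] - p.@[xs i 0]))%classic.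
    by apply: filterI; [exact: nbhs_right_gt|exact: covc].
  by exists c.
move=> y uy; have [/xs_min[i ->]|yNmin] := pselect (is_minimizer p u y).
  have [e e0 xse] := interior_min (xs_u i) (xs_int i).
  have [c c0 [d d0 cd]] := local_min_growth e0 xse (xs_hess i).
  near=> z a.
  have ac : a <= c by near: a; exact: nbhs_right_le.
  move=> _; exists i.
  have zd : `|z - xs i| < d.
    rewrite distrC; near: z; apply/(@nbhs_normP R 'rV[R]_l); exists d => //= z.
  have := cd _ zd; rewrite subrKC; apply: le_trans.
  by rewrite ler_wpM2r ?exprn_ge0.
have lt_y : p.@[xs i0 0] < p.@[y 0].
  have [ui imin] := xs_u i0; rewrite ltNge; apply/negP => le_y.
  by apply: yNmin; split=> // z uz; apply: le_trans le_y (imin _ uz).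
pose e := (p.@[y 0] - p.@[xs i0 0]) / 2.
have e0 : 0 < e by rewrite divr_gt0 // subr_gt0.
near=> z a.
have a0 : 0 < a by near: a; exact: nbhs_right_gt.
have ae : a <= e by near: a; exact: nbhs_right_le.
move=> uz; exists i0.
have pz : p.@[y 0] - p.@[z 0] <= e.
  rewrite (le_trans (ler_norm _)) //; near: z.
  by have /cvgrPdist_le := @meval_continuous p y; apply.
apply: (@le_trans _ _ e); last by rewrite /e in pz *; lra.
have : `|z - xs i0| <= 1.
  apply: norm_le_coord => // i; rewrite !mxE ler_norml.
  have := uz i; have := (xs_u i0).1 i; rewrite !mxE => /andP[? ?] /andP[? ?].
  by apply/andP; split; lra.
move=> z1; rewrite -[leRHS]mulr1; apply: ler_pM => //.
- exact: ltW.
- by rewrite exprn_ge0.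
- by rewrite exprn_ile1.
Unshelve. all: by end_near.
Qed.

End Growth.

(** * The boxes kept by the algorithm *)

Section Algorithm.
Variables (R : realType) (l : nat).
Implicit Types (w : 'I_l -> nat) (k : {ffun 'I_l -> nat}) (r mu : 'I_l).
Implicit Types (u : box R l) (L : seq (box R l)) (K : seq {ffun 'I_l -> nat}).

Lemma box_eq u u' : lo u = lo u' -> hi u = hi u' -> u = u'.
Proof.
case: u u' => [a b ab] [a' b' ab'] /= eqa eqb; case: _ / eqa in ab' *.
by case: _ / eqb in ab' *; rewrite (Prop_irrelevance ab ab').
Qed.

Lemma dyadic_ltP w k mu :
  (\row_mu ((k mu)%:R / 2 ^+ w mu) : 'rV[R]_l) 0 mu <
  (\row_mu ((k mu).+1%:R / 2 ^+ w mu) : 'rV[R]_l) 0 mu.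
Proof. by rewrite !mxE ltr_pM2r ?invr_gt0 ?exprn_gt0 // ltr_nat. Qed.

(** The cell of index [k] of the grid of mesh [2 ^- w mu] in direction [mu].
    The exponent depends on the direction because an iteration bisects the
    directions one after the other. *)
Definition dyadic_box w k : box R l := Box (dyadic_ltP w k).

Definition child r k (b : bool) : {ffun 'I_l -> nat} :=
  [ffun mu => if mu == r then ((k mu).*2 + b)%N else k mu].

Definition refine w r mu := (w mu + (mu == r))%N.

Lemma half_dyadic (n e : nat) : (n.*2)%:R / 2 ^+ e.+1 = n%:R / 2 ^+ e :> R.
Proof. by rewrite -muln2 natrM exprSr -mulf_div divff ?mulr1 ?pnatr_eq0. Qed.

Lemma mid_dyadic (n e : nat) :
  ((n%:R / 2 ^+ e + n.+1%:R / 2 ^+ e) / 2 : R) = (n.*2.+1)%:R / 2 ^+ e.+1.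
Proof.
have e2 : 2 ^+ e != 0 :> R by rewrite expf_neq0 ?pnatr_eq0.
by rewrite -[n.+1%:R]natr1 -[n.*2.+1%:R]natr1 -muln2 natrM exprSr; field.
Qed.

Lemma lower_half_dyadic w k r : lower_half (dyadic_box w k) r =
  dyadic_box (refine w r) (child r k false).
Proof.
apply: box_eq => /=; apply/rowP => mu; rewrite !mxE ffunE /refine.
  by case: eqP => _; rewrite ?addn0 // addn1 half_dyadic.
case: eqP => [->|_]; last by rewrite addn0.
by rewrite /midpoint /= !mxE mid_dyadic addn0 addn1.
Qed.

Lemma upper_half_dyadic w k r : upper_half (dyadic_box w k) r =
  dyadic_box (refine w r) (child r k true).
Proof.
apply: box_eq => /=; apply/rowP => mu; rewrite !mxE ffunE /refine.
  case: eqP => [->|_]; last by rewrite addn0.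
  by rewrite /midpoint /= !mxE mid_dyadic !addn1.
case: eqP => _; rewrite ?addn0 //.
by rewrite !addn1 -doubleS half_dyadic.
Qed.

Lemma bisect_dyadic w K r : bisect r [seq dyadic_box w k | k <- K] =
  [seq dyadic_box (refine w r) k
     | k <- [seq child r k b | k <- K, b <- [:: false; true]]].
Proof.
elim: K => //= k K IHK; rewrite -IHK /bisect /=.
by rewrite lower_half_dyadic upper_half_dyadic.
Qed.

Lemma child_inj r k k' b b' :
  child r k b = child r k' b' -> k = k' /\ b = b'.
Proof.
move=> /ffunP eq_c.
have kr mu : mu != r -> k mu = k' mu.
  by move=> /negbTE mur; have := eq_c mu; rewrite !ffunE mur.
have := eq_c r; rewrite !ffunE eqxx => eq_r.
have eqb : b = b'.
  have /(congr1 odd) := eq_r; rewrite !oddD !odd_double.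
  by case: b b' {eq_c eq_r} => [] [].
split=> //; apply/ffunP => mu; have [->|/kr//] := eqVneq mu r.
move: eq_r; rewrite eqb => /eqP; rewrite eqn_add2r => /eqP eq_d.
by rewrite -[LHS]doubleK eq_d doubleK.
Qed.

(** [t] is the threshold [p_up]; the attained bound is what prevents the
    cut-off from removing a box that contains a minimizer. *)
Lemma cutoff_map (T : eqType) (p : {mpoly R[l]}) (f : T -> box R l)
    (s : seq T) :
    s != [::] ->
  exists2 t, cutoff p [seq f a | a <- s] =
      [seq f a | a <- s & minB p (f a) <= t] &
    (forall a, a \in s -> t <= maxB p (f a)) /\
    (exists2 a, a \in s & t = maxB p (f a)).
Proof.
case: s => // a0 s _; exists (p_up p (f a0) [seq f a | a <- s]).
  apply: etrans (filter_map f _ (a0 :: s)) _; congr map.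
  by apply: eq_filter => a /=; rewrite leNgt.
rewrite /p_up; elim: s => [|a s [IHle [j js IHeq]]].
  rewrite big_nil; split=> [a|]; first by rewrite inE => /eqP ->.
  by exists a0; rewrite ?mem_head.
rewrite /= big_cons; split=> [i|].
  rewrite !inE orbCA => /predU1P[->|i_s]; first by rewrite ge_min lexx.
  by rewrite ge_min IHle ?orbT // inE.
rewrite /Order.min; case: ifP => _.
  by exists a; rewrite // !inE eqxx orbT.
by exists j => //; move: js; rewrite !inE => /orP[] ->; rewrite ?orbT.
Qed.

Section Invariant.
Variables (p : {mpoly R[l]}) (xstar : 'rV[R]_l).
Hypothesis xstar_min : is_minimizer p (unit_box R l) xstar.

(** The list is described by distinct grid indices, which make it possible to
    count boxes although boxes have no decidable equality.  The comparison of
    [minB] with [maxB] is what the cut-off test achieves: the threshold lies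
    between them.  Together with the box that contains [xstar], it bounds the
    [minB] of all the boxes that are kept. *)
Definition pcba_invariant w L := exists K,
  [/\ uniq K, L = [seq dyadic_box w k | k <- K],
      {in K, forall k mu, (k mu < 2 ^ w mu)%N},
      {in K &, forall k k',
         minB p (dyadic_box w k) <= maxB p (dyadic_box w k')} &
      exists2 k, k \in K & box_set (dyadic_box w k) xstar].

Lemma dyadic_sub_unit w k x : (forall mu, (k mu < 2 ^ w mu)%N) ->
  box_set (dyadic_box w k) x -> box_set (unit_box R l) x.
Proof.
move=> kw kx mu; have := kx mu; rewrite !mxE => /andP[kx1 kx2].
rewrite (le_trans _ kx1) ?divr_ge0 ?exprn_ge0 //=.
rewrite (le_trans kx2) // ler_pdivrMr ?exprn_gt0 // mul1r.
by rewrite -natrX ler_nat kw.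
Qed.

Lemma pcba_invariant_step w L r : pcba_invariant w L ->
  pcba_invariant (refine w r) (cutoff p (bisect r L)).
Proof.
move=> [K [uK -> Kw KK [k0 k0K k0x]]]; rewrite bisect_dyadic.
set K' := [seq child r k b | k <- K, b <- _]; set f := dyadic_box _.
have uK' : uniq K'.
  apply: allpairs_uniq => // -[k b] [k' b'] _ _ /= /child_inj[-> ->] //.
have K'w : {in K', forall k mu, (k mu < 2 ^ refine w r mu)%N}.
  move=> _ /allpairsP[[k b] [/= kK _ ->]] mu; have := Kw k kK mu.
  rewrite /refine ffunE; case: eqP => _; last by rewrite addn0.
  rewrite addn1 expnS mul2n -leq_double doubleS.
  by case: b; rewrite ?addn1 // addn0 => /ltnW.
have [k1 k1K' k1x] : exists2 k, k \in K' & box_set (f k) xstar.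
  have child_K' b : child r k0 b \in K'.
    by apply: allpairs_f => //; case: b; rewrite !inE.
  have [x_lo|x_hi] := leP (xstar 0 r) (midpoint (dyadic_box w k0) r).
    exists (child r k0 false) => // mu; rewrite /f -lower_half_dyadic !mxE.
    have := k0x mu; rewrite !mxE.
    by case: eqP => [->|_ //] /andP[-> _].
  exists (child r k0 true) => // mu; rewrite /f -upper_half_dyadic !mxE.
  have := k0x mu; rewrite !mxE.
  by case: eqP => [->|_ //] /andP[_ ->]; rewrite ltW.
have K'0 : K' != [::] by apply: contraTneq k1K' => ->.
have [t -> [t_le [k2 k2K' tE]]] := cutoff_map p f K'0.
exists [seq k <- K' | minB p (f k) <= t]; split.
- exact: filter_uniq.
- by [].
- by move=> k; rewrite mem_filter => /andP[_]; apply: K'w.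
- move=> k k'; rewrite !mem_filter => /andP[kt _] /andP[_ /t_le].
  exact: le_trans.
exists k1 => //; rewrite mem_filter k1K' andbT.
(* The cell [k1] of [xstar] survives: its [minB] is at most the minimum of [p],
   and the threshold is the [maxB] of some cell [k2], hence at least the value
   of [p] at a corner of [k2]. *)
have /andP[/le_trans-> //] := patch_hull p k1x.
have lo2 : box_set (f k2) (lo (f k2)).
  by move=> mu; rewrite lexx ltW // box_ltP.
have /andP[_] := patch_hull p lo2; rewrite tE; apply: le_trans.
apply: xstar_min.2; exact: dyadic_sub_unit (K'w _ k2K') lo2.
Qed.

Lemma pcba_invariantP n :
  pcba_invariant (fun=> n) (pcba p (unit_box R l) n).
Proof.
elim: n => [|n IHn].
  exists [:: [ffun=> 0%N]].
  have unitE : dyadic_box (fun=> 0%N) [ffun=> 0%N] = unit_box R l.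
    by apply: box_eq; apply/rowP => mu; rewrite !mxE ffunE divr1.
  split=> //=; first by rewrite unitE.
  - by move=> k; rewrite inE => /eqP -> mu; rewrite ffunE.
  - move=> k k'; rewrite !inE => /eqP -> /eqP ->; rewrite unitE.
    by have /andP[h1 h2] := patch_hull p xstar_min.1; apply: le_trans h1 h2.
  - by exists [ffun=> 0%N]; rewrite ?mem_head // unitE; exact: xstar_min.1.
rewrite /pcba iterS -/(pcba _ _ _) /pcba_iteration.
have foldlP s w L : pcba_invariant w L ->
    pcba_invariant (fun mu => w mu + count_mem mu s)%N
           (foldl (fun L r => cutoff p (bisect r L)) L s).
  elim: s w L => [|r s IHs] w L wL /=.
    by congr pcba_invariant: wL; apply/funext => mu; rewrite addn0.
  have := IHs _ _ (pcba_invariant_step r wL); congr pcba_invariant.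
  by apply/funext => mu; rewrite /refine -addnA [mu == r]eq_sym.
have := foldlP (enum 'I_l) _ _ IHn; congr pcba_invariant; apply/funext => mu.
by rewrite count_uniq_mem ?enum_uniq // mem_enum addn1.
Qed.

End Invariant.

End Algorithm.

(** * Counting the cells close to the minimizers *)

(** The union bound over [i] for sup-norm balls of radius [N] in the integer
    lattice, each of which has 2 N + 1 points per coordinate. *)
Lemma size_near_le (I T : finType) (f : I -> T -> nat) (N : nat)
    (s : seq {ffun T -> nat}) : uniq s ->
    (forall k, k \in s -> exists i, forall t,
       (f i t <= k t + N)%N /\ (k t <= f i t + N)%N) ->
  (size s <= #|I| * (N + N).+1 ^ #|T|)%N.
Proof.
move=> us near_s.
pose g (c : I * {ffun T -> 'I_(N + N).+1}) : {ffun T -> nat} :=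
  [ffun t => f c.1 t + c.2 t - N]%N.
have -> : (#|I| * (N + N).+1 ^ #|T|)%N = size (codom g).
  by rewrite size_codom card_prod card_ffun card_ord.
apply: uniq_leq_size => // k /near_s[i kN].
apply/codomP; exists (i, [ffun t => inord (k t + N - f i t)]).
apply/ffunP => t; rewrite !ffunE /=; have [fk kf] := kN t.
rewrite inordK; first by rewrite subnKC // addnK.
by rewrite ltnS leq_subLR addnA leq_add2r.
Qed.

(** The coefficient [maxB] is within O(h^2) of the value of [p] at some point
    [z] of the box, and |z - x| <= h; as the gradient vanishes at [x], the
    Taylor estimate bounds p(z) - p(x) by O(h^2) too. *)
Lemma maxB_near_min (R : realType) (l : nat) (p : {mpoly R[l]})
    (x : 'rV[R]_l) :
    is_minimizer p (unit_box R l) x -> ~ box_boundary (unit_box R l) x ->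
  exists C : R, forall (u : box R l) (h : R), 0 < h <= 1 ->
    (forall mu, 0 <= lo u 0 mu <= 1 /\ hi u 0 mu = lo u 0 mu + h) ->
    box_set u x -> maxB p u <= p.@[x 0] + C * h ^+ 2.
Proof.
move=> xmin x_int; have [e e0 xe] := interior_min xmin x_int.
have [D D0 grid] := patch_grid p; have [K K0 Kp] := taylor2 x p.
exists (D + 2 * K) => u h h01 uh ux.
have [J ->] := maxB_attained p u; have [z uz zJ] := grid u h h01 uh J.
have /andP[h0 h1] := h01.
have zx : `|z - x| <= h.
  apply: norm_le_coord => [|mu]; first exact: ltW.
  have := ux mu; have := uz mu; have [_ ->] := uh mu.
  rewrite !mxE ler_norml => /andP[? ?] /andP[? ?].
  by apply/andP; split; lra.
have [_] := Kp _ (le_trans zx h1).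
rewrite (local_min_dirder0 e0 xe) subr0 subrKC.
move: zJ; rewrite !ler_norml => /andP[_ zJ] /andP[_ d2] /andP[_ d3].
have n0 := normr_ge0 (z - x).
have n2 : K * `|z - x| ^+ 2 <= K * h ^+ 2.
  by rewrite ler_wpM2l // ler_pXn2r // nnegrE // ltW.
have n3 : K * `|z - x| ^+ 3 <= K * `|z - x| ^+ 2.
  by rewrite ler_wpM2l // exprS ler_piMl // ?exprn_ge0 // (le_trans zx).
have : 0 <= K * `|z - x| ^+ 2 by rewrite mulr_ge0 // exprn_ge0.
by lra.
Qed.

Lemma dyadic_box_width (R : realType) (l n : nat) (k : {ffun 'I_l -> nat}) :
    (forall mu, (k mu < 2 ^ n)%N) ->
  forall mu, 0 <= lo (dyadic_box R (fun=> n) k) 0 mu <= 1 /\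
    hi (dyadic_box R (fun=> n) k) 0 mu =
    lo (dyadic_box R (fun=> n) k) 0 mu + (2 ^+ n)^-1.
Proof.
move=> kn mu; rewrite /= !mxE; split; last by rewrite -natr1 mulrDl mul1r.
rewrite divr_ge0 ?exprn_ge0 //= ler_pdivrMr ?exprn_gt0 // mul1r.
by rewrite -natrX ler_nat ltnW.
Qed.

(** Passing from reals to grid indices: the cell of index [k] contains [z], and
    rounding [X * 2 ^+ n] down costs one more unit. *)
Lemma dyadic_near (R : realType) (X z : R) (n k M : nat) : 0 <= X ->
    k%:R / 2 ^+ n <= z <= k.+1%:R / 2 ^+ n ->
    `|z - X| <= M%:R * (2 ^+ n)^-1 ->
  (Num.trunc (X * 2 ^+ n) <= k + M.+1)%N /\
  (k <= Num.trunc (X * 2 ^+ n) + M.+1)%N.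
Proof.
move=> X0; have p0 : 0 < 2 ^+ n :> R by rewrite exprn_gt0.
rewrite ler_pdivrMr // ler_pdivlMr // => /andP[kz zk].
rewrite ler_norml -mulNr ler_pdivrMr // ler_pdivlMr // mulrBl => /andP[h1 h2].
have /truncn_itv/andP[f1 f2] : 0 <= X * 2 ^+ n by rewrite mulr_ge0 // ltW.
move: f1 f2 zk; set f := Num.trunc _.
rewrite -[f.+1%:R]natr1 -[k.+1%:R]natr1 => f1 f2 zk.
by split; rewrite -(ler_nat R) natrD -[M.+1%:R]natr1; lra.
Qed.

Theorem theorem16 (R : realType) (l : nat) (p : {mpoly R[l]})
    (m : nat) (xs : 'I_m -> 'rV[R]_l)
    (xs_inj : injective xs)
    (xs_min : forall x : 'rV[R]_l,
       is_minimizer p (unit_box R l) x <-> exists i : 'I_m, x = xs i)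
    (xs_int : forall i : 'I_m, ~ box_boundary (unit_box R l) (xs i))
    (xs_hess : forall i : 'I_m, posdef (hessian p (xs i))) :
  exists C n0 : nat, forall n : nat, (n0 <= n)%N ->
    (size (pcba p (unit_box R l) n) <= C)%N.
Proof.
have [c c0 growth] := quadratic_growth xs_min xs_int xs_hess.
have xs_u i : is_minimizer p (unit_box R l) (xs i) by apply/xs_min; exists i.
have [i0 _] : exists i : 'I_m, true.
  have [|i _] := growth 0; last by exists i.
  by move=> mu; rewrite !mxE lexx ler01.
have [C maxB_le] := maxB_near_min (xs_u i0) (xs_int i0).
have [D D0 grid] := patch_grid p.
(* c |z - x|^2 <= (C + D) h^2 forces |z - x| <= M h as soon as
   (C + D) / c <= M^2, which follows from (C + D) / c <= M since M >= 1. *)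
pose M := (Num.trunc ((C + D) / c)).+1.
exists (m * (M.+1 + M.+1).+1 ^ l)%N, 0%N => n _.
have [K [uK -> Kn KK [k0 k0K k0x]]] := pcba_invariantP (xs_u i0) n.
rewrite size_map -[m in (m * _)%N]card_ord -[l in (_ ^ l)%N]card_ord.
pose h : R := (2 ^+ n)^-1.
have h01 : 0 < h <= 1.
  by rewrite invr_gt0 exprn_gt0 //= invf_le1 ?exprn_gt0 // exprn_ege1 // ler1n.
have /andP[h0 h1] := h01.
apply: (size_near_le (f := fun i mu => Num.trunc (xs i 0 mu * 2 ^+ n))) => //.
move=> k kK.
have [J minBE] := minB_attained p (dyadic_box R (fun=> n) k).
have [z kz zJ] := grid _ h h01 (dyadic_box_width R (Kn k kK)) J.
have uz := dyadic_sub_unit (Kn k kK) kz.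
have [i zi] := growth z uz; exists i => mu.
have le_max := maxB_le _ h h01 (dyadic_box_width R (Kn k0 k0K)) k0x.
have zM : `|z - xs i| <= M%:R * h.
  have xs_eq : p.@[xs i0 0] = p.@[xs i 0].
    by apply/le_anti; rewrite (xs_u i0).2 ?(xs_u i).2 //; exact: (xs_u _).1.
  have zh : c * `|z - xs i| ^+ 2 <= (C + D) * h ^+ 2.
    apply: le_trans zi _; have := KK _ _ kK k0K; rewrite minBE.
    by move: zJ; rewrite ler_norml => /andP[zJ1 zJ2]; rewrite -xs_eq; lra.
  have MM : (C + D) / c <= M%:R ^+ 2.
    apply: le_trans (ltW (truncnS_gt _)) _; rewrite -/M expr2.
    by rewrite -natrM ler_nat leq_pmulr.
  have hM0 : 0 <= M%:R * h by rewrite mulr_ge0 // ltW.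
  rewrite -(ler_pXn2r (n := 2)) ?nnegrE // exprMn.
  rewrite -(ler_pM2l c0); apply: le_trans zh _.
  by rewrite [leRHS]mulrA ler_pM2r ?exprn_gt0 // [leRHS]mulrC -ler_pdivrMr.
apply: (@dyadic_near R (xs i 0 mu) (z 0 mu) n (k mu) M).
- by have /andP[] := (xs_u i).1 mu; rewrite !mxE.
- by have := kz mu; rewrite !mxE.
- apply: le_trans zM; have := coord_le_norm (z - xs i) mu.
  by rewrite !mxE.
Qed.
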